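(* Let $f:\mathbb{R}^n\to\mathbb{R}\cup\{+\infty\}$ and $g:\mathbb{R}^m\to\mathbb{R}\cup\{+\infty\}$ be proper lower semicontinuous convex functions and $A\in\mathbb{R}^{m\times n}$, and consider the primal-dual problem $\min_x\max_\lambda L(x,\lambda)=f(x)-\lambda^TAx-g^*(\lambda)$. Let $0<\eta\le1/\|A\|_2$ and let $z^k=(x^k,\lambda^k)$, $k\ge0$, be generated by the primal-dual hybrid gradient method (PDHG) $$x^{k+1}=\arg\min_x\Big\{f(x)-\langle A^T\lambda^k,x-x^k\rangle+\tfrac1{2\eta}\|x-x^k\|_2^2\Big\},$$ $$\lambda^{k+1}=\arg\min_\lambda\Big\{g^*(\lambda)+\langle A(2x^{k+1}-x^k),\lambda-\lambda^k\rangle+\tfrac1{2\eta}\|\lambda-\lambda^k\|_2^2\Big\}.$$ Set $\bar z^k=(\bar x^k,\bar\lambda^k)=\frac1k\sum_{i=1}^kz^i$. Then for every $k\ge1$ and every $z=(x,\lambda)\in\mathbb{R}^n\times\mathbb{R}^m$, $$L(\bar x^k,\lambda)-L(x,\bar\lambda^k)\le\frac{\|z-z^0\|_P^2}{2k},\qquad P=\begin{pmatrix}\frac1\eta I & A^T \\ A & \frac1\eta I\end{pmatrix}.$$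
   Context: $g^*(\lambda)=\max_y\{\lambda^Ty-g(y)\}$ (i.e. supremum) is the convex conjugate of $g$; $\|A\|_2$ is the spectral norm (with $1/\|A\|_2=+\infty$ if $A=0$); $\|z\|_P^2=z^TPz$. Convention for extended values: $L(x,\lambda)=+\infty$ if $f(x)=+\infty$, and $L(x,\lambda)=-\infty$ if $f(x)<+\infty$ and $g^*(\lambda)=+\infty$. *)

(* Defs.v *)
From mathcomp Require Import all_boot all_order all_algebra.
From mathcomp Require Import all_classical all_reals all_analysis.

Set Implicit Arguments.
Unset Strict Implicit.
Unset Printing Implicit Defensive.

Import Order.TTheory GRing.Theory Num.Theory.
Import numFieldNormedType.Exports.

Local Open Scope classical_set_scope.
Local Open Scope ring_scope.

Section Defs.
Context {R : realType}.

Definition dot n (u v : 'cV[R]_n) : R := \sum_i u i 0 * v i 0.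

(* The library norm [`|u|] on matrices is the max norm. *)
Definition norm2 n (u : 'cV[R]_n) : R := Num.sqrt (dot u u).

(* The operator norm induced by [norm2]. The set is nonempty and bounded, so
   this [sup] is a genuine supremum. *)
Definition spectral_norm m n (A : 'M[R]_(m, n)) : R :=
  sup [set norm2 (A *m x) | x in [set x : 'cV[R]_n | norm2 x <= 1]].

Definition qform n (P : 'M[R]_n) (z : 'cV[R]_n) : R := (z^T *m P *m z) 0 0.

(* Proper includes having no value -oo, so that f takes its values in
   R U {+oo}. *)
Definition proper_fun n (f : 'cV[R]_n -> \bar R) : Prop :=
  (forall x, (-oo < f x)%E) /\ (exists x, (f x < +oo)%E).

(* The library's [convex_function] is restricted to real-valued functions.
   At t = 0 and t = 1 the convention 0 * +oo = 0 applies. *)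
Definition convex_efun n (f : 'cV[R]_n -> \bar R) : Prop :=
  forall (x y : 'cV[R]_n) (t : R), 0 <= t <= 1 ->
    (f (t *: x + (1 - t)%R *: y)%R <= t%:E * f x + (1 - t)%:E * f y)%E.

Definition proper_lsc_convex n (f : 'cV[R]_n -> \bar R) : Prop :=
  [/\ proper_fun f, lower_semicontinuous f & convex_efun f].

Definition conjugate m (g : 'cV[R]_m -> \bar R) (lam : 'cV[R]_m) : \bar R :=
  ereal_sup [set ((dot lam y)%:E - g y)%E | y in [set: 'cV[R]_m]].

Definition is_argmin (T : Type) (F : T -> \bar R) (u : T) : Prop :=
  forall v, (F u <= F v)%E.

(* The case split is needed because in [ereal_scope] the expression
   +oo - r - +oo evaluates to -oo, whereas L is +oo wherever f is. *)
Definition lagrangian m n (f : 'cV[R]_n -> \bar R) (g : 'cV[R]_m -> \bar R)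
    (A : 'M[R]_(m, n)) (x : 'cV[R]_n) (lam : 'cV[R]_m) : \bar R :=
  if f x == +oo%E then +oo%E
  else if conjugate g lam == +oo%E then -oo%E
  else (f x - (dot lam (A *m x))%:E - conjugate g lam)%E.

Definition pdhg m n (f : 'cV[R]_n -> \bar R) (g : 'cV[R]_m -> \bar R)
    (A : 'M[R]_(m, n)) (eta : R)
    (xs : nat -> 'cV[R]_n) (lams : nat -> 'cV[R]_m) : Prop :=
  forall k,
    is_argmin (fun x => (f x - (dot (A^T *m lams k) (x - xs k))%:E
                 + (1 / (2 * eta) * norm2 (x - xs k) ^+ 2)%:E)%E)
      (xs k.+1) /\
    is_argmin (fun lam => (conjugate g lam
                 + (dot (A *m (2 *: xs k.+1 - xs k)) (lam - lams k))%:E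
                 + (1 / (2 * eta) * norm2 (lam - lams k) ^+ 2)%:E)%E)
      (lams k.+1).

(* The initial iterate u 0 is not part of the average. *)
Definition ergodic_mean n (u : nat -> 'cV[R]_n) (k : nat) : 'cV[R]_n :=
  k%:R^-1 *: \sum_(1 <= i < k.+1) u i.

Definition pdhg_metric m n (A : 'M[R]_(m, n)) (eta : R) : 'M[R]_(n + m) :=
  block_mx (eta^-1%:M) A^T A (eta^-1%:M).

End Defs.

(* Main.v *)
Require Import Defs.
From mathcomp Require Import all_boot all_order all_algebra.
From mathcomp Require Import all_classical all_reals all_analysis.
From mathcomp Require Import ring lra.
Import numFieldNormedType.Exports.
Local Open Scope ring_scope.
Import Order.TTheory GRing.Theory Num.Theory.
Local Open Scope classical_set_scope.

(** One step of the method satisfies an exact three-point inequality in the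
    metric [P]. The two argmin conditions, turned into variational inequalities
    ([prox_variational]), add up to
      [L(x+, l) - L(x, l+) <= <P (z+ - zk), z - z+>],
    because the extrapolation [2 x+ - xk] is what makes the cross terms in [A]
    symmetric, and the right-hand side equals
      [(|z - zk|_P^2 - |z - z+|_P^2 - |z+ - zk|_P^2) / 2].
    The step-size condition is used only through [P >= 0]
    ([pdhg_metric_form_ge0]): it drops the last term, after which summing over
    the steps telescopes ([pdhg_step], [pdhg_ergodic_gap_bound]). Jensen's
    inequality for [f] and for the conjugate of [g] ([convex_ergodic_mean])
    passes from the average of the gaps to the gap at the averages.

    This computation is over the reals, so the values of [f] and of the
    conjugate at the iterates must be finite. That holds at a minimizer of a
    proximal objective as soon as the function is proper ([argmin_finite]). The
    conjugate is proper because [g] has an affine minorant, and this is where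
    semicontinuity enters. The proximal point of [g] at a point [y0] of its
    domain exists by compactness of cubes ([prox_exists]); coercivity comes from
    a lower bound of linear growth, itself due to convexity and the minimum of
    [g] over a cube ([convex_growth]). The variational inequality at that
    proximal point [p] is then an affine minorant of slope [y0 - p].

    If [f x] or the conjugate at [lam] is infinite, the difference of
    Lagrangians is [-oo], since both averages have finite values. *)

Set Implicit Arguments.
Unset Strict Implicit.
Unset Printing Implicit Defensive.

(** * Euclidean inner product *)

Section Dot.
Context {R : realType}.
Implicit Types n : nat.

Lemma dotC n (u v : 'cV[R]_n) : dot u v = dot v u.
Proof. by apply: eq_bigr => i _; rewrite mulrC. Qed.

Lemma dotDl n (u v w : 'cV[R]_n) : dot (u + v) w = dot u w + dot v w.
Proof. by rewrite -big_split; apply: eq_bigr => i _; rewrite mxE mulrDl. Qed.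

Lemma dotZl n c (u w : 'cV[R]_n) : dot (c *: u) w = c * dot u w.
Proof. by rewrite mulr_sumr; apply: eq_bigr => i _; rewrite mxE mulrA. Qed.

Lemma dotNl n (u w : 'cV[R]_n) : dot (- u) w = - dot u w.
Proof. by rewrite -scaleN1r dotZl mulN1r. Qed.

Lemma dotDr n (u v w : 'cV[R]_n) : dot w (u + v) = dot w u + dot w v.
Proof. by rewrite dotC dotDl !(dotC w). Qed.

Lemma dotZr n c (u w : 'cV[R]_n) : dot w (c *: u) = c * dot w u.
Proof. by rewrite dotC dotZl dotC. Qed.

Lemma dotNr n (u w : 'cV[R]_n) : dot w (- u) = - dot w u.
Proof. by rewrite dotC dotNl dotC. Qed.

Lemma dot0l n (w : 'cV[R]_n) : dot 0 w = 0.
Proof. by rewrite -(scale0r 0) dotZl mul0r. Qed.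

Definition dotE := (dotDl, dotDr, dotNl, dotNr, dotZl, dotZr).

Lemma dot_ge0 n (u : 'cV[R]_n) : 0 <= dot u u.
Proof. by apply: sumr_ge0 => i _; rewrite -expr2 sqr_ge0. Qed.

Lemma sqr_norm2 n (u : 'cV[R]_n) : norm2 u ^+ 2 = dot u u.
Proof. by rewrite sqr_sqrtr // dot_ge0. Qed.

Lemma norm2_ge0 n (u : 'cV[R]_n) : 0 <= norm2 u.
Proof. exact: sqrtr_ge0. Qed.

Lemma norm2Z n c (u : 'cV[R]_n) : norm2 (c *: u) = `|c| * norm2 u.
Proof. by rewrite /norm2 !dotE mulrA -expr2 sqrtrM ?sqr_ge0 // sqrtr_sqr. Qed.

Lemma coord_le_norm2 n (u : 'cV[R]_n) i : `|u i 0| <= norm2 u.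
Proof.
rewrite -sqrtr_sqr ler_wsqrtr // /dot (bigD1 i) //= -expr2 lerDl.
by apply: sumr_ge0 => j _; rewrite -expr2 sqr_ge0.
Qed.

Lemma norm2_eq0 n (u : 'cV[R]_n) : norm2 u = 0 -> u = 0.
Proof.
move=> u0; apply/matrixP => i j; rewrite (ord1 j) mxE; apply/eqP.
by rewrite -normr_le0 -u0 coord_le_norm2.
Qed.

Lemma dot_mulmx_tr m n (A : 'M[R]_(m, n)) (u : 'cV[R]_m) (v : 'cV[R]_n) :
  dot (A^T *m u) v = dot u (A *m v).
Proof.
have dotM p (a b : 'cV[R]_p) : dot a b = (a^T *m b) 0 0.
  by rewrite mxE; apply: eq_bigr => i _; rewrite mxE.
by rewrite !dotM trmx_mul trmxK mulmxA.
Qed.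

End Dot.

(** * Minimization of lower semicontinuous functions *)

Section LscMin.
Context {R : realType}.

Lemma exists_real_between (a b : \bar R) : (a < b)%E ->
  exists r : R, (a <= r%:E)%E /\ (r%:E < b)%E.
Proof.
case: a b => [a||] [b||] //=.
- by move=> ab; exists a.
- by move=> _; exists a; rewrite ltry.
- by move=> _; exists (b - 1); rewrite leNye lte_fin ltrBlDr ltrDl.
- by move=> _; exists 0; rewrite leNye ltry.
Qed.

(** The nonempty sublevel sets of [h] in [K] generate a filter. Any of its
    cluster points is a minimizer: by semicontinuity, a larger value there would
    keep a whole neighborhood out of some sublevel set. *)
Lemma compact_lsc_min (T : topologicalType) (h : T -> \bar R) (K : set T) y0 :
  compact K -> K y0 -> lower_semicontinuous h ->
  exists2 p, K p & forall y, K y -> (h p <= h y)%E.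
Proof.
move=> cptK Ky0 lsch.
have [[y1 Ky1 y1fin]|ally] := pselect (exists2 y, K y & h y != +oo%E); last first.
  exists y0 => // y Ky; suff -> : h y = +oo%E by rewrite leey.
  by apply/eqP/negPn/negP => hy; apply: ally; exists y.
pose D := [set a : R | exists2 y, K y & (h y <= a%:E)%E].
pose B (a : R) := K `&` [set y | (h y <= a%:E)%E].
have Dne : exists a, D a.
  have [|a [ya _]] := @exists_real_between (h y1) +oo%E; first by rewrite ltey.
  by exists a, y1.
have FB : Filter (filter_from D B).
  apply: filter_from_filter => // a b Da Db; exists (Num.min a b).
    by case: (leP a b).
  move=> y [Ky /= hy]; split; split => //=; apply: le_trans hy _;
    by rewrite lee_fin ge_min lexx ?orbT.
have FBp : ProperFilter (filter_from D B).
  by apply: filter_from_proper => a [y Ky hy]; exists y.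
have FK : filter_from D B K by case: Dne => a Da; exists a => // y [].
have [p [Kp clp]] := cptK _ FBp FK.
exists p => // y Ky; rewrite leNgt; apply/negP => /exists_real_between[a [ya ap]].
have [V pV hV] := lsch p a ap.
have [z [[_ /= za] Vz]] : B a `&` V !=set0.
  by apply: clp => //; exists a => //; exists y.
by have := lt_le_trans (hV z Vz) za; rewrite ltxx.
Qed.

Lemma trmx_continuous m n : continuous (@trmx R m n).
Proof.
move=> /= M s /= /(nbhs_ballP (M^T)) [e e0 es].
apply/nbhs_ballP; exists e => //= N [_ MN]; apply/es; split => // i j.
by rewrite !mxE; apply: MN.
Qed.

Lemma cube_compact n (c : 'cV[R]_n) (r : R) :
  compact [set y : 'cV[R]_n | forall i, `|y i 0 - c i 0| <= r].
Proof.
have := @rV_compact R n (fun i => `[c i 0 - r, c i 0 + r]) _.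
move=> /(_ (fun i => @segment_compact _ _ _)) /= cptr.
have := continuous_compact (continuous_subspaceT (@trmx_continuous 1 n)) cptr.
congr compact; apply/seteqP; split => [_ [y /= yr <-] i|y /= yr].
  by have := yr i; rewrite mxE ler_distl /= in_itv.
exists y^T; last by rewrite trmxK.
by move=> i /=; rewrite in_itv /= mxE -ler_distl.
Qed.

Lemma lscD_continuous (T : topologicalType) (h : T -> \bar R) (q : T -> R) :
  lower_semicontinuous h -> continuous q ->
  lower_semicontinuous (fun y => h y + (q y)%:E)%E.
Proof.
move=> lsch ctsq x a; rewrite addeC -lteBlDl // => ax.
have [b [ab bh]] : exists b : R, a - q x < b /\ (b%:E < h x)%E.
  move: ax; rewrite -EFinB; case: (h x) => [r||] //= ar.
    exists ((a - q x + r) / 2); move: ar; rewrite !lte_fin => ar; split; lra.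
  by exists (a - q x + 1); rewrite ltry; split => //; lra.
have [V xV hV] := lsch x b bh.
have qV : nbhs x [set y | a - b < q y].
  by apply: (cvgr_gt (q x)); [exact: ctsq|lra].
exists (V `&` [set y | a - b < q y]); first exact: filterI.
move=> y [Vy /= qy]; have := hV y Vy.
case: (h y) => [r||] //=; rewrite ?ltry //.
by rewrite -EFinD !lte_fin => br; lra.
Qed.

Lemma dot_self_continuous n (c : 'cV[R]_n) :
  continuous (fun y : 'cV[R]_n => dot (y - c) (y - c)).
Proof.
apply: continuous_big => [|i _ y]; first exact: add_continuous.
have ci : (z - c) i 0 @[z --> y] --> (y - c) i 0.
  rewrite [X in X @ _ --> _](_ : _ = fun z : 'cV[R]_n => z i 0 - c i 0); last first.
    by apply/funext => z; rewrite !mxE.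
  rewrite !mxE.
  exact: (@cvgB _ _ _ (nbhs y) _ (fun z : 'cV[R]_n => z i 0) (fun=> c i 0) _ _
            (@coord_continuous _ _ _ i 0 y) (@cvg_cst _ _ _ _ _)).
exact: (@cvgM _ _ (nbhs y) _ _ _ _ _ ci ci).
Qed.

End LscMin.

(** * Proximal points and conjugates of convex functions *)

Section Convex.
Context {R : realType}.

(** The first-order argument: a gap that is at most the second-order error
    [t * B] for all small steps [t] is nonpositive. *)
Lemma le0_of_le_small (X B : R) :
  0 <= B -> (forall t, 0 < t <= 1 -> X <= t * B) -> X <= 0.
Proof.
move=> B0 XB; rewrite leNgt; apply/negP => X0.
have XB0 : 0 < X + B by lra.
(* At this [t] the bound [X <= t * B] reads [X + B <= B]. *)
have /XB : 0 < X / (X + B) <= 1.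
  by rewrite divr_gt0 // ler_pdivrMr // mul1r; lra.
rewrite mulrAC ler_pdivlMr // ler_pM2l //; lra.
Qed.

(** The common shape of the two subproblems of the method; with [c = 0] and
    [eta = 1] it is also the objective of the proximal point of [F] at [a]. *)
Definition prox_objective n (F : 'cV[R]_n -> \bar R) (c a : 'cV[R]_n) (eta : R)
    (w : 'cV[R]_n) : \bar R :=
  (F w + (dot c (w - a))%:E + (1 / (2 * eta) * norm2 (w - a) ^+ 2)%:E)%E.

(** Comparing [u] with the point [t *: v + (1 - t) *: u], convexity bounds the
    increase of [F] linearly in [t], while the quadratic term contributes its
    derivative at [u] and an error of order [t ^+ 2]; dividing by [t] leaves
    the first-order terms. *)
Lemma prox_variational n (F : 'cV[R]_n -> \bar R) (c a u v : 'cV[R]_n)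
    (eta fu fv : R) :
  convex_efun F -> 0 < eta -> F u = fu%:E -> F v = fv%:E ->
  is_argmin (prox_objective F c a eta) u ->
  fu - fv <= dot c (v - u) + eta^-1 * dot (u - a) (v - u).
Proof.
move=> cvxF eta0 Fu Fv umin.
suff : fu - fv - dot c (v - u) - eta^-1 * dot (u - a) (v - u) <= 0 by lra.
have eta0' : 0 < eta^-1 by rewrite invr_gt0.
apply: (@le0_of_le_small _ (eta^-1 / 2 * dot (v - u) (v - u))) => [|t /andP[t0 t1]].
  by rewrite mulr_ge0 ?dot_ge0 //; lra.
rewrite -(ler_pM2l t0).
have := cvxF v u t; rewrite (ltW t0) t1 => /(_ isT).
rewrite Fu Fv -!EFinM -EFinD; set w := (_ + _)%R => Fw.
have := umin w; rewrite /prox_objective Fu => minw.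
have {minw Fw} := le_trans minw (leeD (leeD Fw (lexx _)) (lexx _)).
rewrite -!EFinD lee_fin !sqr_norm2.
have -> : w - a = (u - a) + t *: (v - u).
  by rewrite /w; apply/matrixP => i j; rewrite !mxE; ring.
have -> : 1 / (2 * eta) = eta^-1 / 2 by rewrite mul1r invfM mulrC.
move: (u - a) (v - u) eta^-1 => d e h; rewrite !dotE (dotC e d).
move: (dot c d) (dot c e) (dot d d) (dot d e) (dot e e) => p q r s s'; lra.
Qed.

Lemma argmin_finite n (F : 'cV[R]_n -> \bar R) (c a u : 'cV[R]_n) (eta : R) :
  proper_fun F -> is_argmin (prox_objective F c a eta) u ->
  exists r : R, F u = r%:E.
Proof.
move=> [Fgt [v Fv]] /(_ v); rewrite /prox_objective.
case: (F u) (Fgt u) => [r||] //; first by exists r.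
by case: (F v) Fv (Fgt v).
Qed.

(** Let [c] be the minimum of [g] over the unit cube around [y0]. A point [y] at
    distance [s > 1] from [y0] is reached from [y0] through a point of that cube
    at the fraction [s^-1] of the way; since [g] is at least [c] there, convexity
    bounds how fast [g] can decrease along the ray. *)
Lemma convex_growth n (g : 'cV[R]_n -> \bar R) (y0 : 'cV[R]_n) (g0 : R) :
  proper_lsc_convex g -> g y0 = g0%:E ->
  exists C : R, 0 <= C /\
    forall y, ((g0 - C * (1 + norm2 (y - y0)))%:E <= g y)%E.
Proof.
move=> [[ggt _] lscg cvxg] gy0.
have y01 : [set y : 'cV[R]_n | forall i, `|y i 0 - y0 i 0| <= 1] y0.
  by move=> i; rewrite subrr normr0.
have [p _ pmin] := compact_lsc_min (cube_compact (c := y0) (r := 1)) y01 lscg.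
have [c gpc] : exists c : R, g p = c%:E.
  have := pmin y0 y01; rewrite gy0; case: (g p) (ggt p) => [c||] //.
  by exists c.
have cg0 : c <= g0 by have := pmin y0 y01; rewrite gy0 gpc lee_fin.
exists (g0 - c); split; first lra.
move=> y; set s := norm2 _; have s0 : 0 <= s := norm2_ge0 _.
have [s1|s1] := leP s 1.
  apply: (@le_trans _ _ c%:E).
    by rewrite lee_fin; nra.
  rewrite -gpc; apply: pmin => i; have := coord_le_norm2 (y - y0) i.
  by rewrite !mxE => /le_trans; apply.
have sp : 0 < s by lra.
pose w := s^-1 *: y + (1 - s^-1) *: y0.
have wy0 : w - y0 = s^-1 *: (y - y0).
  by apply/matrixP => i j; rewrite !mxE; ring.
have gw : (c%:E <= g w)%E.
  rewrite -gpc; apply: pmin => i; have := coord_le_norm2 (w - y0) i.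
  rewrite wy0 norm2Z -/s (@ger0_norm _ s^-1) ?invr_ge0 // mulVf ?gt_eqF //.
  by rewrite -wy0 !mxE.
case gy : (g y) (ggt y) => [r||] // _; last by rewrite leey.
have := cvxg y y0 s^-1; rewrite invr_ge0 s0 invf_le1 // (ltW s1) => /(_ isT).
move=> /(le_trans gw); rewrite gy gy0 -!EFinM -EFinD !lee_fin => cr.
have {cr} : s * c <= s * (s^-1 * r + (1 - s^-1) * g0) by rewrite ler_pM2l.
have -> : s * (s^-1 * r + (1 - s^-1) * g0) = r + (s - 1) * g0.
  by field; rewrite gt_eqF.
by nra.
Qed.

(** Linear decrease of [g] is beaten by the quadratic term, so that outside a
    large cube the objective exceeds its value at [y0]. *)
Lemma prox_exists n (g : 'cV[R]_n -> \bar R) (y0 : 'cV[R]_n) :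
  proper_lsc_convex g -> (g y0 < +oo)%E ->
  exists p, is_argmin (prox_objective g 0 y0 1) p.
Proof.
move=> pg; have [[ggt _] lscg cvxg] := pg.
case gy0 : (g y0) (ggt y0) => [g0||] // _ _.
have [C [C0 Cg]] := convex_growth pg gy0.
have hE w : prox_objective g 0 y0 1 w =
    (g w + (1 / 2 * dot (w - y0) (w - y0))%:E)%E.
  by rewrite /prox_objective dot0l adde0 mulr1 sqr_norm2.
(* For [s > 2 * C + 2] one has [C * (1 + s) < s ^+ 2 / 2]. *)
pose r := 2 * C + 2.
have y0r : [set y : 'cV[R]_n | forall i, `|y i 0 - y0 i 0| <= r] y0.
  by move=> i; rewrite subrr normr0 /r; lra.
have lsch : lower_semicontinuous
    (fun w => g w + (1 / 2 * dot (w - y0) (w - y0))%:E)%E.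
  apply: lscD_continuous => // w.
  exact: (@cvgM _ _ (nbhs w) _ (fun=> 1 / 2) _ _ _ (@cvg_cst _ _ _ _ _)
            (@dot_self_continuous _ _ y0 w)).
have [p _ pmin] := compact_lsc_min (cube_compact (c := y0) (r := r)) y0r lsch.
exists p => w; rewrite !hE.
have [wr|wr] := leP (norm2 (w - y0)) r.
  apply: pmin => i; have := coord_le_norm2 (w - y0) i.
  by rewrite !mxE => /le_trans; apply.
apply: le_trans (pmin y0 y0r) _.
rewrite subrr dot0l mulr0 adde0 gy0.
apply: le_trans (leeD (Cg w) (lexx _)).
rewrite -EFinD lee_fin -sqr_norm2.
move: (norm2 _) wr; rewrite /r => s sr; nra.
Qed.

(** The proximal point [p] of [g] at [y0] satisfies
    [g y >= g p + <y0 - p, y - p>] for all [y]: it has [y0 - p] as a subgradient. *)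
Lemma affine_minorant n (g : 'cV[R]_n -> \bar R) :
  proper_lsc_convex g ->
  exists (l : 'cV[R]_n) (b : R), forall y, ((dot l y - b)%:E <= g y)%E.
Proof.
move=> pg; have [prg lscg cvxg] := pg; have [ggt [y0 gy0]] := prg.
have [p pmin] := prox_exists pg gy0.
have [gp gpE] := argmin_finite prg pmin.
exists (y0 - p), (dot (y0 - p) p - gp) => y.
case gy : (g y) (ggt y) => [r||] // _; last by rewrite leey.
have := prox_variational cvxg ltr01 gpE gy pmin.
rewrite dot0l invr1 mul1r lee_fin !dotE; lra.
Qed.

(** Properness is what keeps the dual iterates in the domain of the conjugate:
    were the conjugate identically [+oo], every point would be an argmin. *)
Lemma conjugate_proper n (g : 'cV[R]_n -> \bar R) :
  proper_lsc_convex g -> proper_fun (conjugate g).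
Proof.
move=> pg; have [[ggt [y0 gy0]] _ _] := pg; split.
  move=> l; apply: (@lt_le_trans _ _ ((dot l y0)%:E - g y0)%E).
    by case: (g y0) gy0 (ggt y0) => [r||] // _ _; rewrite -EFinB ltNyr.
  by apply: ereal_sup_ubound; exists y0.
have [l [b lb]] := affine_minorant pg.
exists l; apply: (@le_lt_trans _ _ b%:E); last by rewrite ltry.
apply: ge_ereal_sup => _ [y _ <-].
case: (g y) (lb y) (ggt y) => [r||] //; last by rewrite leNye.
by rewrite -EFinB !lee_fin; lra.
Qed.

Lemma conjugate_convex n (g : 'cV[R]_n -> \bar R) :
  (forall y, (-oo < g y)%E) -> convex_efun (conjugate g).
Proof.
move=> ggt l1 l2 t /andP[t0 t1]; apply: ge_ereal_sup => _ [y _ <-].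
case gy : (g y) (ggt y) => [r||] // _; last by rewrite leNye.
have sup l : ((dot l y - r)%:E <= conjugate g l)%E.
  by apply: ereal_sup_ubound; exists y => //; rewrite gy.
apply: (@le_trans _ _ (t%:E * (dot l1 y - r)%:E + (1 - t)%:E * (dot l2 y - r)%:E)%E).
  by rewrite -!EFinM -!EFinD lee_fin !dotE; lra.
by apply: leeD; apply: lee_wpmul2l; rewrite ?lee_fin ?subr_ge0.
Qed.

Lemma ergodic_meanS n (u : nat -> 'cV[R]_n) k :
  ergodic_mean u k.+1 = k.+1%:R^-1 *: \sum_(i < k.+1) u i.+1.
Proof. by rewrite /ergodic_mean big_add1 big_mkord. Qed.

(** Jensen's inequality, by induction on the number of terms: the mean of
    [k.+2] points is a convex combination of the last one and of the mean of
    the others, with weight [k.+2%:R^-1] on the last. *)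
Lemma convex_ergodic_mean n (F : 'cV[R]_n -> \bar R) (u : nat -> 'cV[R]_n)
    (phi : nat -> R) k :
  convex_efun F -> (forall i, F (u i.+1) = (phi i)%:E) ->
  (F (ergodic_mean u k.+1) <= (k.+1%:R^-1 * \sum_(i < k.+1) phi i)%:E)%E.
Proof.
move=> cvxF Fu; elim: k => [|k IHk].
  by rewrite ergodic_meanS !big_ord1 invr1 scale1r mul1r Fu.
have k1 : k.+1%:R != 0 :> R by rewrite pnatr_eq0.
have k2 : k.+2%:R != 0 :> R by rewrite pnatr_eq0.
have kS : k.+2%:R = k.+1%:R + 1 :> R by rewrite -natr1.
pose t : R := k.+2%:R^-1.
have t01 : 0 <= t <= 1 by rewrite invr_ge0 ler0n invf_le1 ?ltr0n // ler1n.
have t1 : 1 - t = k.+1%:R / k.+2%:R.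
  by apply: (mulIf k2); rewrite mulrBl mulVf // mul1r divfK // kS addrK.
have -> : ergodic_mean u k.+2 = t *: u k.+2 + (1 - t) *: ergodic_mean u k.+1.
  rewrite !ergodic_meanS big_ord_recr /= scalerDr addrC scalerA t1.
  by congr (_ + _ *: _); rewrite mulrAC divff // mul1r.
apply: le_trans (cvxF _ _ _ t01) _; rewrite Fu.
apply: (@le_trans _ _ (t%:E * (phi k.+1)%:E +
    (1 - t)%:E * (k.+1%:R^-1 * \sum_(i < k.+1) phi i)%:E)%E).
  by apply: leeD => //; apply: lee_wpmul2l => //; rewrite lee_fin; lra.
rewrite -!EFinM -EFinD lee_fin t1 addrC.
rewrite [\sum_(i < k.+2) _]big_ord_recr mulrDr /t.
by rewrite mulrA (mulrAC k.+1%:R) divff // mul1r.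
Qed.

End Convex.

(** * The metric of the method *)

Section Metric.
Context {R : realType} (m n : nat) (A : 'M[R]_(m, n)).
Implicit Types (x u : 'cV[R]_n) (l : 'cV[R]_m).

(** The supremum defining the spectral norm is a true upper bound because the
    entries of [A *m v] are at most the absolute row sums of [A] when [v] has
    norm at most 1; the general case follows by scaling. *)
Lemma norm2_mulmx_le x : norm2 (A *m x) <= spectral_norm A * norm2 x.
Proof.
have unit_le u : norm2 u <= 1 -> norm2 (A *m u) <= spectral_norm A.
  move=> u1; apply: ub_le_sup; last by exists u.
  exists (Num.sqrt (\sum_i (\sum_j `|A i j|) ^+ 2)) => _ [v /= v1 <-].
  apply: ler_wsqrtr; apply: ler_sum => i _.
  rewrite -expr2 -real_normK ?num_real // lerXn2r ?nnegrE ?sumr_ge0 // mxE.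
  apply: le_trans (ler_norm_sum _ _ _) _; apply: ler_sum => j _.
  by rewrite normrM ler_piMr // (le_trans (coord_le_norm2 _ _)).
have [x0|x0] := eqVneq (norm2 x) 0.
  by rewrite x0 mulr0 (norm2_eq0 x0) mulmx0 /norm2 dot0l sqrtr0.
have xgt0 : 0 < norm2 x by rewrite lt_neqAle eq_sym x0 norm2_ge0.
have := unit_le ((norm2 x)^-1 *: x).
rewrite -scalemxAr !norm2Z ger0_norm ?invr_ge0 ?norm2_ge0 // mulVf // lexx.
by move=> /(_ isT); rewrite ler_pdivrMl // mulrC.
Qed.

Context (eta : R) (eta_gt0 : 0 < eta)
        (eta_le : (eta%:E <= ((spectral_norm A)%:E)^-1)%E).

Lemma step_size_contraction x : eta ^+ 2 * dot (A *m x) (A *m x) <= dot x x.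
Proof.
have Ax := norm2_mulmx_le x.
rewrite -!sqr_norm2 -exprMn lerXn2r ?nnegrE ?mulr_ge0 ?norm2_ge0 ?(ltW eta_gt0) //.
have [s0|s0] := eqVneq (spectral_norm A) 0.
  move: Ax; rewrite s0 mul0r => Ax; apply: le_trans (norm2_ge0 x).
  by rewrite pmulr_rle0.
move: eta_le; rewrite inver (negbTE s0) lee_fin => etas.
have s_gt0 : 0 < spectral_norm A by rewrite -invr_gt0 (lt_le_trans eta_gt0).
apply: le_trans (ler_wpM2l (ltW eta_gt0) Ax) _.
rewrite mulrA ler_piMl ?norm2_ge0 //.
by rewrite -ler_pdivlMr // mul1r.
Qed.

(** The quadratic form of [P], with the blocks expanded. *)
Definition pdhg_metric_form x l : R :=
  eta^-1 * dot x x + 2 * dot l (A *m x) + eta^-1 * dot l l.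

Lemma qform_pdhg_metric x l :
  qform (pdhg_metric A eta) (col_mx x l) = pdhg_metric_form x l.
Proof.
have dotM p (a b : 'cV[R]_p) : (a^T *m b) 0 0 = dot a b.
  by rewrite mxE; apply: eq_bigr => i _; rewrite mxE.
rewrite /qform /pdhg_metric -mulmxA mul_block_col tr_col_mx mul_row_col.
rewrite mxE !dotM !mul_scalar_mx !dotE -dot_mulmx_tr trmxK dotC.
rewrite /pdhg_metric_form -(dot_mulmx_tr A l x); ring.
Qed.

(** Completing the square in [l] leaves
    [eta^-1 * (|x|^2 - eta ^+ 2 * |A x|^2)], nonnegative when [eta] times the
    spectral norm is at most 1. *)
Lemma pdhg_metric_form_ge0 x l : 0 <= pdhg_metric_form x l.
Proof.
have eta0' : 0 < eta^-1 by rewrite invr_gt0.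
have -> : pdhg_metric_form x l =
    eta^-1 * dot (l + eta *: (A *m x)) (l + eta *: (A *m x))
    + eta^-1 * (dot x x - eta ^+ 2 * dot (A *m x) (A *m x)).
  rewrite /pdhg_metric_form !dotE (dotC (A *m x) l).
  by field; rewrite gt_eqF.
apply: addr_ge0; apply: mulr_ge0; rewrite ?dot_ge0 ?(ltW eta0') //.
by rewrite subr_ge0 step_size_contraction.
Qed.

End Metric.

(** * One step and its ergodic average *)

Section Iteration.
Context {R : realType} (m n : nat) (A : 'M[R]_(m, n)) (eta : R).

(** The first two bounds are the variational inequalities of the primal and of
    the dual update. In the increments [x - x1], [x1 - xk], [l - l1], [l1 - lk],
    the difference between the two sides of the conclusion is the sum of their
    slacks and of half the form at [z1 - zk]. *)
Lemma pdhg_step (xk x1 x : 'cV[R]_n) (lk l1 l : 'cV[R]_m) (f1 fx g1 gl : R) :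
  0 < eta -> (eta%:E <= ((spectral_norm A)%:E)^-1)%E ->
  f1 - fx <= dot (- (A^T *m lk)) (x - x1) + eta^-1 * dot (x1 - xk) (x - x1) ->
  g1 - gl <= dot (A *m (2 *: x1 - xk)) (l - l1)
             + eta^-1 * dot (l1 - lk) (l - l1) ->
  (f1 - dot l (A *m x1) - gl) - (fx - dot l1 (A *m x) - g1)
  <= (pdhg_metric_form A eta (x - xk) (l - lk)
      - pdhg_metric_form A eta (x - x1) (l - l1)) / 2.
Proof.
move=> eta0 etale hf hg.
have := pdhg_metric_form_ge0 eta0 etale (x1 - xk) (l1 - lk).
have -> : x - xk = (x - x1) + (x1 - xk) by rewrite addrA subrK.
have -> : l - lk = (l - l1) + (l1 - lk) by rewrite addrA subrK.
have -> : dot l (A *m x1) = dot (l - l1) (A *m x1) + dot l1 (A *m x1).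
  by rewrite -dotDl subrK.
have -> : dot l1 (A *m x) = dot l1 (A *m (x - x1)) + dot l1 (A *m x1).
  by rewrite -dotDr -mulmxDr subrK.
have hfE : dot (- (A^T *m lk)) (x - x1)
           = dot (l1 - lk) (A *m (x - x1)) - dot l1 (A *m (x - x1)).
  by rewrite dotNl dot_mulmx_tr dotDl dotNl addrAC subrr add0r.
have hgE : A *m (2 *: x1 - xk) = A *m x1 + A *m (x1 - xk).
  by rewrite -mulmxDr scaler_nat mulr2n addrA.
move: hf hg; rewrite hfE hgE {hfE hgE} /pdhg_metric_form.
move: (x - x1) (x1 - xk) (l - l1) (l1 - lk) eta^-1 => d e D E h.
rewrite !mulmxDr !dotDl !dotDr (dotC (A *m x1)) (dotC (A *m e)) (dotC d e) (dotC D E).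
move: (dot d d) (dot e e) (dot e d) (dot D D) (dot E E) (dot E D) => dd ee ed DD EE ED.
move: (dot D (A *m d)) (dot D (A *m e)) (dot E (A *m d)) (dot E (A *m e)) => Dd De Ed Ee.
move: (dot D (A *m x1)) (dot l1 (A *m x1)) (dot l1 (A *m d)) => Dx lx ld.
(* What remains is a linear identity between slacks. *)
rewrite -(subr_ge0 (f1 - fx)) -(subr_ge0 (g1 - gl)) => hf hg hge.
rewrite -subr_ge0.
have half_ge0 : (0 : R) <= 2^-1 by rewrite invr_ge0.
have := addr_ge0 (addr_ge0 hf hg) (mulr_ge0 hge half_ge0).
by congr (0 <= _); field.
Qed.

Lemma pdhg_ergodic_gap_bound (xs : nat -> 'cV[R]_n) (lams : nat -> 'cV[R]_m)
    (phi psi : nat -> R) (x : 'cV[R]_n) (l : 'cV[R]_m) (fx gl : R) k :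
  0 < eta -> (eta%:E <= ((spectral_norm A)%:E)^-1)%E ->
  (forall i, phi i - fx <= dot (- (A^T *m lams i)) (x - xs i.+1)
               + eta^-1 * dot (xs i.+1 - xs i) (x - xs i.+1)) ->
  (forall i, psi i - gl <= dot (A *m (2 *: xs i.+1 - xs i)) (l - lams i.+1)
               + eta^-1 * dot (lams i.+1 - lams i) (l - lams i.+1)) ->
  (k.+1%:R^-1 * \sum_(i < k.+1) phi i - dot l (A *m ergodic_mean xs k.+1) - gl)
  - (fx - dot (ergodic_mean lams k.+1) (A *m x)
        - k.+1%:R^-1 * \sum_(i < k.+1) psi i)
  <= pdhg_metric_form A eta (x - xs 0%N) (l - lams 0%N) / (2 * k.+1%:R).
Proof.
move=> eta0 etale hphi hpsi.
have k0 : (0 : R) < k.+1%:R by rewrite ltr0n.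
pose gap i := (phi i - dot l (A *m xs i.+1) - gl)
              - (fx - dot (lams i.+1) (A *m x) - psi i).
pose V i := pdhg_metric_form A eta (x - xs i) (l - lams i).
have sum_le N : \sum_(i < N) gap i <= (V 0%N - V N) / 2.
  elim: N => [|N IHN]; first by rewrite big_ord0 subrr mul0r.
  rewrite big_ord_recr /=.
  have := pdhg_step eta0 etale (hphi N) (hpsi N).
  by rewrite -/(V N) -/(V N.+1) -/(gap N); lra.
have mean_gap : \sum_(i < k.+1) gap i = k.+1%:R *
   ((k.+1%:R^-1 * \sum_(i < k.+1) phi i - dot l (A *m ergodic_mean xs k.+1) - gl)
  - (fx - dot (ergodic_mean lams k.+1) (A *m x)
        - k.+1%:R^-1 * \sum_(i < k.+1) psi i)).
  have -> : dot l (A *m ergodic_mean xs k.+1)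
            = k.+1%:R^-1 * \sum_(i < k.+1) dot l (A *m xs i.+1).
    rewrite ergodic_meanS -scalemxAr dotZr mulmx_sumr; congr (_ * _).
    by elim/big_rec2: _ => [|i y1 y2 _ <-]; rewrite ?dotDr // dotC dot0l.
  have -> : dot (ergodic_mean lams k.+1) (A *m x)
            = k.+1%:R^-1 * \sum_(i < k.+1) dot (lams i.+1) (A *m x).
    rewrite ergodic_meanS dotZl; congr (_ * _).
    by elim/big_rec2: _ => [|i y1 y2 _ <-]; rewrite ?dotDl // dot0l.
  rewrite /gap !sumrB !sumr_const !card_ord -(mulr_natl gl) -(mulr_natl fx).
  by field; rewrite gt_eqF.
rewrite invfM mulrA ler_pdivlMr // mulrC -mean_gap.
apply: le_trans (sum_le k.+1) _.
by have := pdhg_metric_form_ge0 eta0 etale (x - xs k.+1) (l - lams k.+1); rewrite /V; lra.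
Qed.

End Iteration.

Unset Implicit Arguments.

(* The step-size bound uses the extended-real inverse, for which 0^-1 = +oo.
   The difference in the conclusion uses the dual addition [%dE] on \bar R, for
   which +oo - +oo = -oo - -oo = +oo: an indeterminate difference would violate
   the bound, so the statement also asserts that none occurs. *)
Theorem corollary2 (R : realType) (m n : nat)
    (f : 'cV[R]_n -> \bar R) (g : 'cV[R]_m -> \bar R) (A : 'M[R]_(m, n))
    (eta : R) (xs : nat -> 'cV[R]_n) (lams : nat -> 'cV[R]_m)
    (hf : proper_lsc_convex f) (hg : proper_lsc_convex g)
    (eta_gt0 : 0 < eta)
    (eta_le : (eta%:E <= ((spectral_norm A)%:E)^-1)%E)
    (hpdhg : pdhg f g A eta xs lams)
    (k : nat) (k_ge1 : (1 <= k)%N)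
    (x : 'cV[R]_n) (lam : 'cV[R]_m) :
  (lagrangian f g A (ergodic_mean xs k) lam
     - lagrangian f g A x (ergodic_mean lams k)
   <= (qform (pdhg_metric A eta)
         (col_mx x lam - col_mx (xs 0%N) (lams 0%N)) / (2 * k%:R))%:E)%dE.
Proof.
have prf : proper_fun f by case: hf.
have cvxf : convex_efun f by case: hf.
have prg := conjugate_proper hg.
have cvxg : convex_efun (conjugate g).
  by case: hg => [[ggt _] _ _]; apply: conjugate_convex.
have minx i : is_argmin
    (prox_objective f (- (A^T *m lams i)) (xs i) eta) (xs i.+1).
  by move=> v; rewrite /prox_objective !dotNl !EFinN; apply: (hpdhg i).1.
have minl i : is_argmin (prox_objective (conjugate g)
    (A *m (2 *: xs i.+1 - xs i)) (lams i) eta) (lams i.+1).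
  exact: (hpdhg i).2.
have [phi fE] := choice (fun i => argmin_finite prf (minx i)).
have [psi gE] := choice (fun i => argmin_finite prg (minl i)).
case: k k_ge1 => // k' _.
have := convex_ergodic_mean k' cvxf fE.
have := convex_ergodic_mean k' cvxg gE.
rewrite /lagrangian.
case fm : (f (ergodic_mean xs k'.+1)) (prf.1 (ergodic_mean xs k'.+1)) => [fb||] // _.
case gm : (conjugate g (ergodic_mean lams k'.+1)) (prg.1 (ergodic_mean lams k'.+1)) => [gb||] // _.
rewrite !lee_fin => gb_le fb_le /=.
(* Where [f x] or the conjugate at [lam] is [+oo], the difference is [-oo]. *)
case gl : (conjugate g lam) (prg.1 lam) => [gr||] // _ /=;
  case fx : (f x) (prf.1 x) => [fr||] // _ /=; try by rewrite leNye.
rewrite opp_col_mx add_col_mx qform_pdhg_metric.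
have := pdhg_ergodic_gap_bound k' eta_gt0 eta_le
  (fun i => prox_variational cvxf eta_gt0 (fE i) fx (minx i))
  (fun i => prox_variational cvxg eta_gt0 (gE i) gl (minl i)).
rewrite lee_fin => /(le_trans _); apply; apply: lerB.
  by rewrite !lerD2r.
by rewrite lerD2l lerN2.
Qed.
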